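(* Let $f:X\to X$ be the endomorphism of the compact abelian group $X=\widehat{\mathbb{Z}[\frac13]}$ dual to the map $\phi:x\mapsto 2x$ on the (discrete) additive group $\mathbb{Z}[\frac13]$, and let $g:\mathbb{T}\to\mathbb{T}$ be the circle-doubling map $x\mapsto 2x \bmod 1$ on $\mathbb{T}=\mathbb{R}/\mathbb{Z}$. For a map $T$ and an integer $N\ge 1$ let $\pi_T(N)$ denote the number of closed orbits of $T$ of length at most $N$. Then $$\pi_f(N)\le \pi_g(N)\quad\text{for all integers } N\ge 1,$$ and, as $N\to\infty$ through the positive integers, $$\limsup_{N\to\infty}\frac{N\,\pi_f(N)}{2^{N+1}}\le 1,\qquad \liminf_{N\to\infty}\frac{N\,\pi_f(N)}{2^{N+1}}\ge\frac13 .$$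
   Context: $\mathbb{Z}[\frac13]$ is the ring of rationals whose denominator is a power of $3$. Its additive group is given the discrete topology, and $X=\widehat{\mathbb{Z}[\frac13]}$ is its Pontryagin dual (the compact group of characters $\chi:\mathbb{Z}[\frac13]\to S^1$). The dual map is $f=\widehat{\phi}$, $f(\chi)=\chi\circ\phi$, where $\phi(x)=2x$. A closed orbit $\tau$ of length $|\tau|=n$ of a map $T:Y\to Y$ is a set $\{x,T(x),T^2(x),\dots,T^n(x)=x\}$ of cardinality $n$. Thus $\pi_T(N)=\#\{\tau : |\tau|\le N\}=\sum_{n\le N}\mathcal{O}_n(T)$, where $\mathcal{O}_n(T)$ is the number of closed orbits of $T$ of length $n$. For $T=f$ and $T=g$ the number of points fixed by $T^n$ is finite for every $n\ge1$, so these quantities are finite. *)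

(* Defs.v *)
From HB Require Import structures.
From mathcomp Require Import all_boot all_order all_algebra.
From mathcomp Require Import generic_quotient ring_quotient complex finmap.
From mathcomp Require Import all_classical all_reals all_analysis.

Set Implicit Arguments.
Unset Strict Implicit.
Unset Printing Implicit Defensive.

Import Order.TTheory GRing.Theory Num.Theory.
Local Open Scope classical_set_scope.
Local Open Scope ring_scope.

(* [denq x] is the denominator of [x] in lowest terms; [3.-nat m] means that
   [m] is a power of 3 (see [p_natP]). *)
Definition Z3frac_pred : {pred rat} := [pred x | 3%N.-nat `|denq x|%N].

Lemma denq_dvd_exp3 (a : int) (k : nat) : a%:~R / (3%:Z ^+ k)%:~R \in Z3frac_pred.
Proof.
have nz : (3%:Z ^+ k != 0) by rewrite expf_neq0.
rewrite inE.
move: nz; move E : (3%:Z ^+ k) => m.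
case: divqP E => [|l x l0] // E _.
have : (`|denq x|%N %| 3 ^ k)%N.
  by rewrite -[(3 ^ k)%N](abszX k 3%:Z) E abszM dvdn_mull.
by move=> /pnat_dvd; apply; rewrite pnatX pnat_id.
Qed.

Lemma Z3fracP (x : rat) :
  reflect (exists (a : int) (k : nat), x = a%:~R / 3 ^+ k) (x \in Z3frac_pred).
Proof.
apply: (iffP idP) => [|[a [k ->]]]; last first.
  by have := denq_dvd_exp3 a k; rewrite rmorphXn.
rewrite inE => /p_natP [k dk]; exists (numq x), k.
by rewrite -{1}[x]divq_num_den -absz_denq dk -natrX pmulrn.
Qed.

Fact Z3frac_subring : subring_closed Z3frac_pred.
Proof.
have nz k : (3 : rat) ^+ k != 0 by rewrite expf_neq0.
split=> [|_ _ /Z3fracP[a [k ->]] /Z3fracP[b [l ->]]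
         |_ _ /Z3fracP[a [k ->]] /Z3fracP[b [l ->]]]; apply/Z3fracP.
- by exists 1, 0%N; rewrite expr0 divr1.
- exists (a * 3 ^+ l - b * 3 ^+ k), (k + l)%N.
  by rewrite -mulNr addf_div// exprD rmorphB !rmorphM !rmorphXn mulNr.
- by exists (a * b), (k + l)%N; rewrite mulf_div exprD rmorphM.
Qed.

HB.instance Definition _ :=
  GRing.isSubringClosed.Build rat Z3frac_pred Z3frac_subring.

Record Z3frac := MkZ3frac { Z3frac_val :> rat; _ : Z3frac_val \in Z3frac_pred }.

HB.instance Definition _ := [isSub for Z3frac_val].
HB.instance Definition _ := [Choice of Z3frac by <:].
HB.instance Definition _ := [SubChoice_isSubComNzRing of Z3frac by <:].

(* Characters of a discrete abelian group: continuity is automatic.  [S^1] is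
   the set of complex numbers of modulus one. *)
Record dual (R : realType) (G : zmodType) := MkDual {
  character :> G -> R[i];
  _ : forall x, `|character x| = 1;
  _ : {morph character : x y / x + y >-> x * y} }.

Lemma dual_norm (R : realType) (G : zmodType) (chi : dual R G) x : `|chi x| = 1.
Proof. by case: chi. Qed.

Lemma dualD (R : realType) (G : zmodType) (chi : dual R G) :
  {morph chi : x y / x + y >-> x * y}.
Proof. by case: chi. Qed.

Section DualMap.
Variables (R : realType) (G : zmodType) (phi : {additive G -> G}).

Fact dual_map_norm (chi : dual R G) x : `|(chi \o phi) x| = 1.
Proof. exact: dual_norm. Qed.

Fact dual_mapD (chi : dual R G) : {morph chi \o phi : x y / x + y >-> x * y}.
Proof. by move=> x y /=; rewrite raddfD dualD. Qed.

Definition dual_map (chi : dual R G) : dual R G :=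
  MkDual (dual_map_norm chi) (dual_mapD chi).

End DualMap.

Definition Z3double (x : Z3frac) : Z3frac := 2 * x.

Fact Z3double_zmod : zmod_morphism Z3double.
Proof. by move=> x y; rewrite /Z3double mulrBr. Qed.

HB.instance Definition _ :=
  GRing.isZmodMorphism.Build Z3frac Z3frac Z3double Z3double_zmod.

Definition dual_doubling (R : realType) : dual R Z3frac -> dual R Z3frac :=
  dual_map Z3double.

Definition integers (R : realType) : {pred R} := [pred x | x \is a Num.int].

Fact integers_zmod (R : realType) : zmod_closed (@integers R).
Proof. by split=> [|x y]; rewrite !inE ?rpred0 //; apply: rpredB. Qed.

HB.instance Definition _ (R : realType) :=
  GRing.isZmodClosed.Build R (@integers R) (@integers_zmod R).

(* The additive group R/Z. *)
Definition circle (R : realType) := Quotient.quot (@integers R).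

Definition circle_doubling (R : realType) (x : circle R) : circle R := x *+ 2.

(* The set {x, T x, ..., T^n x = x}, of cardinality exactly [n]; in particular
   [0 < n], as this set is never empty. *)
Definition closed_orbit (Y : Type) (T : Y -> Y) (n : nat) : set (set Y) :=
  [set tau | exists x : Y, [/\ iter n T x = x,
     tau = [set iter k T x | k in [set k | (k <= n)%N]] & (tau #= `I_n)%card]].

(* [fset_set A] is empty if [A] is infinite, so this is the number of orbits of
   length at most [N] only for maps, such as the two above, all of whose
   iterates have finitely many fixed points. *)
Definition orbit_count (Y : Type) (T : Y -> Y) (N : nat) : nat :=
  #|` fset_set [set tau | exists2 n, (n <= N)%N & closed_orbit T n tau]|.

(* Main.v *)
Require Import Defs.
From mathcomp Require Import all_boot all_order all_algebra.
From mathcomp Require Import all_classical all_reals all_analysis.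
From mathcomp Require Import complex finmap cyclotomic separable zify.
From mathcomp Require Import ring lra.

(** The set [X] of characters of [Z[1/3]] and the circle are compared through
their periodic points.  A character [chi] is fixed by the [n]-th iterate of the
dual of doubling exactly when all its values are roots of unity of order
dividing [m = 2 ^ n - 1] ([fixed_dualP]), and a point [x] of the circle is fixed
by the [n]-th iterate of doubling exactly when [x = j / m] for some [j]
([fixed_circle]).

Upper bounds.  Since [Z[1/3] = Z + m Z[1/3]] ([Z3frac_decomp]), a fixed character
is determined by its value at [1], an [m]-th root of unity.  Taking a discrete
logarithm of this value gives an injection of the fixed characters into the
fixed points of the circle, and it turns the dual map into circle doubling
([dual_circle_semiconj]).  Injective semiconjugacies preserve least periods, and
the points of least period [n] split into closed orbits of [n] points each
([card_least_period]), so there are at most as many closed orbits of length [n]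
on [X] as on the circle.  This gives the inequality between the counting
functions, and also [n O_n <= 2 ^ n], where [O_n] is the number of closed orbits
of length [n] on [X].  As [2 ^ n / n] grows like a geometric sequence of ratio 2,
the sum of the first [N] terms is [2 ^ (N + 1) / N] up to a factor tending to 1
([sum_upper]); hence the bound on the limit superior.

Lower bound.  For odd [n] the number [m] is coprime to [3], so reduction modulo
[m] is defined on [Z[1/3]] and each of the [m] roots of unity is the value at
[1] of a fixed character ([card_fixed_dual]).  The points among these with a
smaller period have period at most [n / 2], so they number [O(2 ^ (n / 2))].
Hence [n O_n >= 2 ^ n - O(2 ^ (n / 2))] for odd [n].  Even lengths are simply
dropped: [N pi(N)] is at least the sum of [n O_n] over odd [n <= N], which is a
geometric sum of ratio 4, about [2 ^ (N + 1) / 3] when [N] is even and twice as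
much when [N] is odd ([sum_lower]). *)

Import Order.TTheory GRing.Theory Num.Theory.
Local Open Scope ring_scope.

Set Implicit Arguments.
Unset Strict Implicit.

(** * Closed orbits and points of given least period *)

Section Orbits.
Local Open Scope classical_set_scope.
Local Open Scope nat_scope.
Variables (Y : Type) (T : Y -> Y).

Definition fixed (n : nat) : set Y := [set x | iter n T x = x].

Definition least_period (n : nat) : set Y :=
  [set x | iter n T x = x /\ forall k, 0 < k < n -> iter k T x <> x].

(** The closed orbit through a point [x] with [iter n T x = x]. *)
Definition iterates (n : nat) (x : Y) : set Y :=
  [set iter k T x | k in [set k | k <= n]].

Lemma iter_modn n k x : iter n T x = x -> iter (k %% n) T x = iter k T x.
Proof.
move=> xn; rewrite {2}(divn_eq k n) addnC iterD; congr iter.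
by elim: (k %/ n) => // q IH; rewrite mulSn iterD -IH.
Qed.

(** Periodicity inverts [T] on the orbit of [x]: [n.-1] further steps undo one
step. *)
Lemma iterK n k x : 0 < n -> iter n T x = x ->
  iter (k * n.-1) T (iter k T x) = x.
Proof.
by move=> n0 xn; rewrite -iterD -mulnSr prednK// -(iter_modn _ xn) modnMl.
Qed.

Lemma least_period_inj n x i j : least_period n x -> i < n -> j < n ->
  iter i T x = iter j T x -> i = j.
Proof.
move=> [xn xk]; wlog ij : i j / i < j => [wl|_ jn eqij].
  by move=> ? ? E; case: (ltngtP i j) => // ?; [|symmetry]; apply: wl.
have /xk[] : 0 < n - j + i < n by lia.
by rewrite iterD eqij -iterD subnK// ltnW.
Qed.

Lemma iterates_iter n k x : 0 < n -> iter n T x = x ->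
  iterates n (iter k T x) = iterates n x.
Proof.
move=> n0 xn; have xkn : iter n T (iter k T x) = iter k T x.
  by rewrite -iterD addnC iterD xn.
apply/seteqP; split => y [j /= _ <-].
  exists ((j + k) %% n) => /=; first by rewrite ltnW ?ltn_mod.
  by rewrite iter_modn// iterD.
exists ((j + k * n.-1) %% n) => /=; first by rewrite ltnW ?ltn_mod.
by rewrite iter_modn// iterD iterK.
Qed.

Lemma closed_orbit0 : closed_orbit T 0 = set0.
Proof.
apply/seteqP; split => // tau [x [_ ->]]; rewrite II0 card_eq0 => /eqP E.
by have : set0 x by rewrite -E; exists 0.
Qed.

Lemma least_period_sub n : least_period n `<=` fixed n.
Proof. by move=> x []. Qed.

(** As in [orbit_count], this is meaningful when there are finitely many closed
orbits of length [n]. *)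
Definition orbits_of_length (n : nat) : nat := #|` fset_set (closed_orbit T n)|.

Lemma orbits_of_length0 : orbits_of_length 0 = 0.
Proof. by rewrite /orbits_of_length closed_orbit0 fset_set0. Qed.

End Orbits.

Section CardOrbits.
Local Open Scope classical_set_scope.
Local Open Scope nat_scope.
Variables (Y : choiceType) (T : Y -> Y).

Lemma iterates_seq n x : 0 < n -> iter n T x = x ->
  iterates T n x = [set` [seq iter k T x | k <- iota 0 n]].
Proof.
move=> n0 xn; apply/seteqP; split => y /=.
  move=> [k /= _ <-]; apply/mapP; exists (k %% n); rewrite ?iter_modn//.
  by rewrite mem_iota add0n ltn_mod.
by move=> /mapP[k]; rewrite mem_iota => kn ->; exists k => //=; lia.
Qed.

Lemma card_eq_seq (s : seq Y) n :
  ([set` s] #= `I_n)%card <-> size (undup s) = n.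
Proof.
have -> : [set` s] = [set` [fset y in s]%fset].
  by apply/seteqP; split => y /=; rewrite inE.
have -> : size (undup s) = #|` [fset y in s]%fset|.
  apply/perm_size/uniq_perm => [||y]; rewrite ?undup_uniq ?fset_uniq//.
  by rewrite mem_undup inE.
by split => /card_eq_fsetP.
Qed.

(** Asking that the orbit has exactly [n] points is asking that [n] is the least
period of its points. *)
Lemma closed_orbitE n : 0 < n ->
  closed_orbit T n = iterates T n @` least_period T n.
Proof.
move=> n0; apply/seteqP; split => tau.
  move=> [x [xn ->]]; rewrite -/(iterates T n x) => cn; exists x => //; split => //.
  pose s := [seq iter k T x | k <- iota 0 n].
  have us : uniq s.
    move: cn; rewrite iterates_seq// => /card_eq_seq E.
    by apply/negPn; rewrite -ltn_size_undup E size_map size_iota ltnn.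
  move=> k /andP[k0 kn] xk.
  have := nth_uniq x _ _ us; move=> /(_ 0 k); rewrite size_map size_iota.
  rewrite !(nth_map 0) ?size_iota// !nth_iota//= add0n xk eqxx => /(_ n0 kn).
  by move/esym; lia.
move=> [x Px <-]; have [xn _] := Px; exists x; split => //.
rewrite iterates_seq//.
set s := [seq _ | _ <- _].
have us : uniq s.
  rewrite map_inj_in_uniq ?iota_uniq// => i j; rewrite !mem_iota => ? ?.
  by apply: least_period_inj Px _ _; lia.
by apply/card_eq_seq; rewrite undup_id// size_map size_iota.
Qed.

Lemma finite_closed_orbit n : (0 < n -> finite_set (least_period T n)) ->
  finite_set (closed_orbit T n).
Proof.
case: n => [_|n fin]; first by rewrite closed_orbit0.
by rewrite closed_orbitE//; apply/finite_image/fin.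
Qed.

(** Double counting: each closed orbit of length [n] contains [n] points of least
period [n], and each such point lies on the orbit of its iterates only. *)
Lemma card_least_period n : 0 < n -> finite_set (least_period T n) ->
  #|` fset_set (least_period T n)| = n * orbits_of_length T n.
Proof.
move=> n0 fin; rewrite /orbits_of_length closed_orbitE// fset_set_image//.
set L := fset_set _; set O := imfset _ _ _.
rewrite card_fset_sum1 (partition_big_imfset _ (iterates T n))/=.
rewrite -/O mulnC card_fset_sum1 big_distrl/= !big_seq; apply: eq_bigr => tau.
move=> /imfsetP[/= x]; rewrite in_fset_set// => /set_mem Px ->; have [xn _] := Px.
rewrite mul1n sum1_count -size_filter.
suff /perm_size -> : perm_eq [seq y <- L | iterates T n y == iterates T n x]
    [seq iter k T x | k <- iota 0 n] by rewrite size_map size_iota.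
apply: uniq_perm; first by rewrite filter_uniq ?fset_uniq.
  rewrite map_inj_in_uniq ?iota_uniq// => i j; rewrite !mem_iota => ? ?.
  by apply: least_period_inj Px _ _; lia.
move=> y; rewrite mem_filter in_fset_set//; apply/andP/idP.
  move=> [/eqP E _].
  have : iterates T n y y by exists 0.
  by rewrite E iterates_seq.
move=> /mapP[k _ ->]; split; first by apply/eqP; exact: iterates_iter.
apply/mem_set; split; first by rewrite -iterD addnC iterD xn.
move=> j jn E; have [_ /(_ _ jn)] := Px; apply.
have xjn : iter n T (iter j T x) = iter j T x by rewrite -iterD addnC iterD xn.
by rewrite -(iterK k n0 xjn) -[iter k T _]iterD addnC iterD E iterK.
Qed.

Lemma orbit_countE N : (forall n, 0 < n -> finite_set (least_period T n)) ->
  orbit_count T N = \sum_(n < N.+1) orbits_of_length T n.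
Proof.
move=> fin; rewrite /orbits_of_length trivIset_sum_card; last 2 first.
- by move=> n; apply/finite_closed_orbit/fin.
- move=> m n _ _ [tau [[x [_ _ cm]] [y [_ _ cn]]]].
  by move: cm; rewrite (card_eql cn) => /card_eq_II.
rewrite /orbit_count; congr #|` fset_set _|; rewrite -bigcup_mkord.
by apply/seteqP; split => tau [n nN ?]; exists n.
Qed.

(** A least period divides every period, so if it is smaller than [n] then it is
at most [n / 2].  The index is shifted to leave out period [0], which fixes
everything. *)
Lemma fixed_sub n : 0 < n ->
  fixed T n `<=` least_period T n `|` \bigcup_(d in `I_(n./2)) fixed T d.+1.
Proof.
move=> n0 x xn; have ex : exists k, (0 < k) && (iter k T x == x).
  by exists n; rewrite n0; apply/eqP.
case: (ex_minnP ex) => d /andP[d0 /eqP xd] dmin.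
have dn : d %| n.
  apply: contraT; rewrite /dvdn -lt0n => r0.
  have := dmin (n %% d); rewrite r0 iter_modn// xn eqxx => /(_ isT).
  by rewrite leqNgt ltn_mod d0.
have [ed|nd] := eqVneq d n.
  left; split => // k /andP[k0 kn] xk.
  by have := dmin k; rewrite k0 xk eqxx => /(_ isT); lia.
right; exists d.-1 => /=; last by rewrite prednK.
move/dvdnP: dn => [[|[|q]] E]; lia.
Qed.

Lemma card_fixed_le n : 0 < n -> (forall k, 0 < k -> finite_set (fixed T k)) ->
  #|` fset_set (fixed T n)| <= #|` fset_set (least_period T n)|
     + \sum_(d < n./2) #|` fset_set (fixed T d.+1)|.
Proof.
move=> n0 fin.
have finP : finite_set (least_period T n).
  by apply: sub_finite_set (fin n n0); exact: least_period_sub.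
have finU h : finite_set (\bigcup_(d in `I_h) fixed T d.+1).
  by apply: bigcup_finite => // d _; exact: fin.
have leU h : #|` fset_set (\bigcup_(d in `I_h) fixed T d.+1)| <=
   \sum_(d < h) #|` fset_set (fixed T d.+1)|.
  elim: h => [|h IH]; first by rewrite II0 bigcup_set0 fset_set0 big_ord0.
  rewrite IIS bigcup_setU bigcup_set1 big_ord_recr/= fset_setU//; last exact: fin.
  by rewrite cardfsU (leq_trans (leq_subr _ _))// leq_add2r.
have sub := fixed_sub n0.
apply: (@leq_trans #|` fset_set (least_period T n `|`
                          \bigcup_(d in `I_(n./2)) fixed T d.+1)|).
  apply: fsubset_leq_card; rewrite -fset_set_sub//; first exact: fin.
  by rewrite finite_setU.
by rewrite fset_setU// cardfsU (leq_trans (leq_subr _ _))// leq_add2l leU.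
Qed.

End CardOrbits.

Section Semiconj.
Local Open Scope classical_set_scope.
Variables (Y Z : Type) (T : Y -> Y) (S : Z -> Z) (h : Y -> Z) (n : nat).

Hypothesis injh : {in fixed T n &, injective h}.
Hypothesis hT : {in fixed T n, forall x, h (T x) = S (h x)}.

Lemma semiconj_iter k x : fixed T n x -> h (iter k T x) = iter k S (h x).
Proof.
move=> xn; elim: k => //= k <-; apply/hT/mem_set.
by rewrite /fixed/= -iterD addnC iterD xn.
Qed.

Lemma card_fixed_semiconj : (fixed T n #<= fixed S n)%card.
Proof.
rewrite -(card_le_eql (inj_card_eq injh)); apply: subset_card_le => _ [x xn <-].
by rewrite /fixed/= -semiconj_iter// xn.
Qed.

Lemma card_least_period_semiconj : (least_period T n #<= least_period S n)%card.
Proof.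
have hiter := semiconj_iter.
have injP : {in least_period T n &, injective h}.
  by move=> x y /set_mem[xn _] /set_mem[yn _]; apply: injh; exact: mem_set.
rewrite -(card_le_eql (inj_card_eq injP)); apply: subset_card_le => _ [x [xn xk] <-].
split=> [|k kn]; first by rewrite -hiter// xn.
rewrite -hiter// => /injh E; apply: (xk k kn); apply: E; apply: mem_set => //.
by rewrite /fixed/= -iterD addnC iterD xn.
Qed.

End Semiconj.

(** * Periodic points of circle doubling *)

Lemma exp2_pred_gt0 n : (0 < n)%N -> (0 < (2 ^ n).-1)%N.
Proof. by move=> n0; rewrite -ltnS prednK ?expn_gt0// -{1}(expn0 2) ltn_exp2l. Qed.

Section Circle.
Variable R : realType.
Local Open Scope quotient_scope.

Definition circle_frac (m j : nat) : circle R :=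
  \pi_(circle R) (j%:R / m%:R : R).

Lemma circle_frac_eq m i j : (0 < m)%N ->
  (circle_frac m i == circle_frac m j) = (i == j %[mod m])%N.
Proof.
move=> m0; have mR : m%:R != 0 :> R by rewrite pnatr_eq0 -lt0n.
rewrite /circle_frac /circle -(Quotient.idealrBE (@integers R)) -mulrBl.
have -> : (i == j %[mod m])%N = (m %| i%:Z - j%:Z)%Z.
  by rewrite -eqz_mod_dvd !modz_nat.
apply/intrP/dvdzP => -[z E]; exists z.
  apply/eqP; rewrite -(eqr_int R) rmorphB rmorphM /= -!pmulrn -E divfK//.
have := congr1 (fun k : int => k%:~R : R) E.
by rewrite rmorphB rmorphM/= -!pmulrn => ->; rewrite mulfK.
Qed.

Lemma iter_circle_doubling n (x : circle R) :
  iter n (@circle_doubling R) x = x *+ (2 ^ n).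
Proof.
elim: n => //= n ->; rewrite /circle_doubling expnS.
by rewrite -mulrnA mulnC.
Qed.

Lemma circle_fracMn m j k : circle_frac m j *+ k = circle_frac m (j * k).
Proof.
by rewrite /circle_frac -raddfMn /= natrM mulrAC mulr_natr.
Qed.

Lemma fixed_circle n : (0 < n)%N ->
  fixed (@circle_doubling R) n =
  [set circle_frac (2 ^ n).-1 j | j in `I_((2 ^ n).-1)]%classic.
Proof.
move=> n0; set m := (2 ^ n).-1.
have m0 : (0 < m)%N := exp2_pred_gt0 n0.
have m2 : (2 ^ n = m.+1)%N by rewrite prednK ?expn_gt0.
have mR : m%:R != 0 :> R by rewrite pnatr_eq0 -lt0n.
apply/seteqP; split => x; rewrite /fixed/= iter_circle_doubling m2; last first.
  move=> [j _ <-]; rewrite circle_fracMn; apply/eqP; rewrite circle_frac_eq//.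
  by rewrite mulnS addnC modnMDl.
move/eqP; rewrite mulrS -subr_eq0 addrAC subrr add0r.
elim/quotW : x => r.
rewrite -raddfMn -(raddf0 (\pi_(circle R))) -(Quotient.idealrBE (@integers R)) subr0.
move=> /intrP[z E].
have zm : 0 <= (z %% m)%Z by rewrite modz_ge0// eqz_nat -lt0n.
exists `|(z %% m)%Z|%N.
  by rewrite /= -ltz_nat gez0_abs// ltz_pmod.
have -> : r = z%:~R / m%:R by rewrite -E -(mulr_natr r) mulfK.
rewrite /circle_frac; apply/eqP; rewrite -(Quotient.idealrBE (@integers R)) -mulrBl.
rewrite natr_absz ger0_norm//.
apply/intrP; exists (- (z %/ m)%Z).
have -> : z%:~R = (z %/ m)%Z%:~R * m%:R + (z %% m)%Z%:~R :> R.
  by rewrite [in LHS](divz_eq z m) intrD intrM -pmulrn.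
by rewrite opprD addrCA subrr addr0 -mulNr mulfK// rmorphN.
Qed.

Lemma fixed_circle_le n : (0 < n)%N ->
  (fixed (@circle_doubling R) n #<= `I_((2 ^ n).-1))%card.
Proof. by move=> n0; rewrite fixed_circle//; exact: card_image_le. Qed.

End Circle.

(** * Periodic characters and their values at 1 *)

Lemma prim_root_exists (F : numClosedFieldType) (n : nat) : (0 < n)%N ->
  exists z : F, n.-primitive_root z.
Proof.
move=> n0; have [r Dp] := closed_field_poly_normal ('X^n - 1 : {poly F}).
rewrite (monicP _) ?monicXnsubC // scale1r in Dp.
have rn1 : all n.-unity_root r.
  by apply/allP=> z; rewrite -root_prod_XsubC -Dp.
have sz_r : (n < (size r).+1)%N.
  by rewrite -(size_prod_XsubC r id) -Dp size_XnsubC.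
have [|z] := hasP (cyclic.has_prim_root n0 rn1 _ sz_r); last by exists z.
by rewrite -separable_prod_XsubC -Dp separable_Xn_sub_1 // pnatr_eq0 -lt0n.
Qed.

Section Characters.
Variables (R : realType) (G : zmodType).
Implicit Types chi psi : dual R G.

Lemma dual_ext chi psi : chi =1 psi -> chi = psi.
Proof.
case: chi psi => [c nc Dc] [p np Dp] /= /funext E.
by rewrite E in nc Dc *; congr MkDual; exact: Prop_irrelevance.
Qed.

Lemma dual_neq0 chi x : chi x != 0.
Proof. by rewrite -normr_eq0 dual_norm oner_eq0. Qed.

Lemma dual0 chi : chi 0 = 1.
Proof.
by apply: (mulfI (dual_neq0 chi 0)); rewrite -dualD addr0 mulr1.
Qed.

Lemma dualMn chi x k : chi (x *+ k) = chi x ^+ k.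
Proof. by elim: k => [|k IH]; rewrite ?dual0// mulrS dualD IH exprS. Qed.

Lemma dualN chi x : chi (- x) = (chi x)^-1.
Proof.
apply: (mulfI (dual_neq0 chi x)).
by rewrite -dualD subrr dual0 mulfV ?dual_neq0.
Qed.

Lemma dualMz chi x (k : int) : chi (x *~ k) = chi x ^ k.
Proof.
case: k => k; first by rewrite -pmulrn dualMn.
by rewrite NegzE mulrNz dualN -pmulrn dualMn exprnN.
Qed.

End Characters.

Section FixedCharacters.
Variable R : realType.
Implicit Types chi psi : dual R Z3frac.

Lemma iter_dual_doubling n chi x :
  iter n (@dual_doubling R) chi x = chi x ^+ (2 ^ n).
Proof.
elim: n x => //= n IH x.
by rewrite IH /Z3double mulr_natl dualMn -exprM expnS.
Qed.

(** The [n]-th iterate of the dual map raises the values of a character to the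
power [2 ^ n], and these values are invertible. *)
Lemma fixed_dualP n chi :
  fixed (@dual_doubling R) n chi <-> forall x, chi x ^+ (2 ^ n).-1 = 1.
Proof.
have m2 : (2 ^ n = (2 ^ n).-1.+1)%N by rewrite prednK ?expn_gt0.
split=> [chin x|chi1].
  apply: (mulfI (dual_neq0 chi x)).
  by rewrite -exprS -m2 -iter_dual_doubling chin mulr1.
by apply/dual_ext => x; rewrite iter_dual_doubling m2 exprS chi1 mulr1.
Qed.

(** Write [m = m' * 3 ^ e] with [m'] coprime to [3]: a Bezout relation
[u * 3 ^ k + v * m' = 1] gives [a / 3 ^ k = a u + m (a v / 3 ^ (k + e))]. *)
Lemma Z3frac_decomp (m : nat) (x : Z3frac) : (0 < m)%N ->
  exists (b : int) (w : Z3frac), x = 1 *~ b + w *+ m.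
Proof.
move=> m0; have [a [k Ex]] := Z3fracP _ (valP x).
have [m' co Em] := pfactor_coprime (isT : prime 3) m0.
set e := logn 3 m in Em.
have [[u v]] : exists uv : int * int, (uv.1 * (3 ^ k)%N + uv.2 * m' = 1)%R.
  have : coprimez (3 ^ k)%N m' by rewrite coprimezE/= coprimeXl.
  by move=> /coprimezP [uv E]; exists uv; rewrite E.
move=> /= E; exists (a * u), (MkZ3frac (denq_dvd_exp3 (a * v) (k + e))).
apply/val_inj; rewrite raddfD raddfMn raddfMz.
suff -> : \val x = 1 *~ (a * u) + ((a * v)%:~R / (3%Z ^+ (k + e))%:~R) *+ m.
  by [].
rewrite Ex.
have n3 j : (3 : rat) ^+ j != 0 by rewrite expf_neq0.
have E' : u%:~R * 3 ^+ k + v%:~R * m'%:R = 1 :> rat.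
  have := congr1 (fun l : int => l%:~R : rat) E.
  by rewrite /= intrD !intrM -!pmulrn natrX.
transitivity (a%:~R * (u%:~R * 3 ^+ k + v%:~R * m'%:R) / 3 ^+ k : rat).
  by rewrite E' mulr1.
rewrite -(mulr_natr _ m) Em natrM natrX rmorphXn/= exprD !intrM.
rewrite -[3%Z%:~R]/(3 : rat).
by field; rewrite !n3.
Qed.

Lemma fixed_dual_inj n chi psi : (0 < n)%N ->
  fixed (@dual_doubling R) n chi ->
  fixed (@dual_doubling R) n psi ->
  chi 1 = psi 1 -> chi = psi.
Proof.
move=> n0 /fixed_dualP chin /fixed_dualP psin E; apply: dual_ext => x.
have [b [w ->]] := Z3frac_decomp x (exp2_pred_gt0 n0).
by rewrite !dualD !dualMn chin psin !dualMz E.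
Qed.

(** The map is [chi |-> j / m], where [chi 1 = z ^ j] for a fixed primitive [m]-th
root of unity [z]; only [j] modulo [m] matters, on both sides. *)
Lemma dual_circle_semiconj n : (0 < n)%N ->
  exists2 h : dual R Z3frac -> circle R,
    {in fixed (@dual_doubling R) n &, injective h} &
    {in fixed (@dual_doubling R) n,
      forall chi, h (@dual_doubling R chi) = @circle_doubling R (h chi)}.
Proof.
move=> n0; set m := (2 ^ n).-1.
have m0 : (0 < m)%N := exp2_pred_gt0 n0.
have [z pz] := prim_root_exists R[i] m0.
have /choice[lg lgE] : forall chi : dual R Z3frac, exists j : nat,
    fixed (@dual_doubling R) n chi -> chi 1 = z ^+ j.
  move=> chi; have [/fixed_dualP chin|] := pselect (fixed (@dual_doubling R) n chi).
    by have [j ->] := prim_rootP pz (chin 1); exists j.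
  by exists 0%N.
exists (fun chi => circle_frac R m (lg chi)).
  move=> chi psi /set_mem chin /set_mem psin /eqP; rewrite circle_frac_eq// => E.
  apply: (@fixed_dual_inj n) => //; rewrite !lgE//; apply/eqP.
  by rewrite (eq_prim_root_expr pz).
move=> chi /set_mem chin; rewrite /circle_doubling circle_fracMn; apply/eqP.
rewrite circle_frac_eq// -(eq_prim_root_expr pz) exprM -!lgE//.
  by rewrite /= /Z3double mulr_natl dualMn.
by rewrite /fixed/= -iterSr iterS chin.
Qed.

End FixedCharacters.

(** * Characters factoring through the integers modulo m *)

Section Residues.
Variable m : nat.
Hypotheses (m1 : (1 < m)%N) (m3 : coprime m 3).

Definition residue (x : Z3frac) : 'Z_m := ratr (\val x).

(** The formula holds for every way of writing [x] with a power of [3] as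
denominator, since these powers are invertible modulo [m]. *)
Lemma residueE (x : Z3frac) (a : int) (k : nat) :
  \val x = a%:~R / 3 ^+ k -> residue x = a%:~R / 3 ^+ k.
Proof.
have u3 j : (3 ^+ j : 'Z_m) \is a GRing.unit by rewrite unitrX// unitZpE.
have n3 j : (3 : rat) ^+ j != 0 by rewrite expf_neq0.
move=> xE; rewrite /residue /ratr.
have /p_natP[l dl] : 3%N.-nat `|denq (\val x)|%N := valP x.
have den : denq (\val x) = (3 ^ l)%N :> int by rewrite -absz_denq dl.
have : numq (\val x) * 3 ^+ k = a * 3 ^+ l.
  apply/eqP; rewrite -(eqr_int rat) !rmorphM !rmorphXn /=; apply/eqP.
  by rewrite numqE den -pmulrn natrX xE mulrAC divfK.
move=> /(congr1 (fun z : int => z%:~R : 'Z_m)).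
rewrite den -pmulrn natrX !intrM !rmorphXn/= => E.
by apply: (mulIr (u3 k)); rewrite divrK// mulrAC E mulrK.
Qed.

Lemma residueD : {morph residue : x y / x + y}.
Proof.
have u3 j : (3 ^+ j : 'Z_m) \is a GRing.unit by rewrite unitrX// unitZpE.
have n3 j : (3 : rat) ^+ j != 0 by rewrite expf_neq0.
move=> x y.
have [a [k xE]] := Z3fracP _ (valP x); have [b [l yE]] := Z3fracP _ (valP y).
rewrite (residueE xE) (residueE yE).
rewrite (@residueE _ (a * 3 ^+ l + b * 3 ^+ k) (k + l)).
  rewrite intrD !intrM !rmorphXn/=; apply: (mulIr (u3 (k + l)%N)).
  rewrite divrK// mulrDl exprD mulrA divrK// mulrA [X in _ = _ + X]mulrAC.
  by rewrite -[b%:~R / _ * _ * _]mulrA mulrA divrK.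
have -> : \val (x + y) = \val x + \val y by [].
by rewrite xE yE addf_div// -exprD intrD !intrM !rmorphXn.
Qed.

Lemma residue1 : residue 1 = 1.
Proof. by rewrite (@residueE 1 1 0) ?expr0 ?divr1. Qed.

End Residues.

Section DualPoints.
Variables (R : realType) (m : nat).
Hypotheses (m1 : (1 < m)%N) (m3 : coprime m 3).
Variables (w : R[i]) (wm : w ^+ m = 1).

Fact residue_char_norm x : `|w ^+ (residue m x : nat)| = 1.
Proof.
have : `|w| ^+ m == 1 by rewrite -normrX wm normr1.
by rewrite pexpr_eq1 ?(ltnW m1)// normrX => /eqP ->; rewrite expr1n.
Qed.

Fact residue_charD :
  {morph (fun x => w ^+ (residue m x : nat)) : x y / x + y >-> x * y}.
Proof.
move=> x y; rewrite residueD//= -exprD -[RHS](expr_mod _ wm); congr (w ^+ (_ %% _)).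
by rewrite Zp_cast.
Qed.

Definition residue_char : dual R Z3frac := MkDual residue_char_norm residue_charD.

Lemma residue_char1 : residue_char 1 = w.
Proof. by rewrite -[LHS]/(w ^+ (residue m 1 : nat)) residue1. Qed.

Lemma residue_charX x : residue_char x ^+ m = 1.
Proof. by rewrite /= exprAC wm expr1n. Qed.

End DualPoints.

(** [2 ^ n - 1 = 2 * 4 ^ (n / 2) - 1] is [1] modulo [3]. *)
Lemma coprime_pred_exp2_3 n : odd n -> coprime (2 ^ n).-1 3.
Proof.
move=> on; rewrite -(odd_double_half n) on add1n expnS -mul2n expnM.
have : (4 ^ n./2 = 1 %[mod 3])%N by rewrite -modnXm exp1n.
rewrite coprime_sym prime_coprime// /dvdn => E.
have := divn_eq (4 ^ n./2) 3; rewrite E => ->; lia.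
Qed.

(** The characters built from the powers of a primitive [m]-th root of unity are
told apart by their values at [1].  For [n = 1] the only fixed character is
trivial; as the ring ['Z_m] is not the integers modulo [m] for [m = 1], this
case is left out. *)
Lemma card_fixed_dual (R : realType) n : odd n -> (1 < n)%N ->
  (`I_(2 ^ n).-1 #<= fixed (@dual_doubling R) n)%card.
Proof.
move=> on n1; set m := (2 ^ n).-1.
have m1 : (1 < m)%N.
  have : (2 ^ 2 <= 2 ^ n)%N by rewrite leq_exp2l.
  by rewrite /m; lia.
have m3 : coprime m 3 by exact: coprime_pred_exp2_3.
have [z pz] := prim_root_exists R[i] (ltnW m1).
have zm j : (z ^+ j) ^+ m = 1 by rewrite exprAC (prim_expr_order pz) expr1n.
pose chi j := residue_char m1 m3 (zm j).
have injchi : {in `I_m &, injective chi}.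
  move=> i j /set_mem/= im /set_mem/= jm /(congr1 (fun c : dual R Z3frac => c 1)).
  rewrite !residue_char1 => /eqP; rewrite (eq_prim_root_expr pz).
  by rewrite !modn_small// => /eqP.
rewrite -(card_le_eql (inj_card_eq injchi)); apply: subset_card_le => _ [j _ <-].
by apply/fixed_dualP => x; exact: residue_charX.
Qed.

(** * Growth of sums *)

Section Growth.
Variable a : nat -> nat.
Local Open Scope nat_scope.

(** The induction replaces [N] by [N + 1] as soon as
[1 / (N - 2) + 1 / (N + 1) <= 2 / (N - 1)], which holds from [N = 5] on; any
[N - c] with [c > 1] instead of [N - 2] would do for large [N]. *)
Lemma sum_upper N : a 0 = 0 -> (forall n, 0 < n -> n * a n <= 2 ^ n) -> 5 <= N ->
  (N - 2) * \sum_(n < N.+1) a n <= 2 ^ N.+1.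
Proof.
move=> a0 an; elim: N => // N IH; rewrite leq_eqVlt => /orP[/eqP <-|].
  have [] := (an 1 isT, an 2 isT); have [] := (an 3 isT, an 4 isT); have := an 5 isT.
  rewrite !big_ord_recr big_ord0 /= a0; lia.
rewrite ltnS => N5; have {}IH := IH N5.
rewrite big_ord_recr/= expnS; have := an N.+1 isT.
move: IH; set P := \sum_(i < _) _; set Q := 2 ^ _; set b := a _ => IH hb.
have [k Nk] : exists k, N = k + 5 by exists (N - 5); lia.
have h1 : (k + 3) * P <= Q by rewrite (_ : k + 3 = N - 2)// Nk; lia.
have h2 : (k + 6) * b <= Q by rewrite (_ : k + 6 = N.+1)// Nk; lia.
have -> : N.+1 - 2 = k + 4 by lia.
rewrite -(@leq_pmul2l ((k + 3) * (k + 6))) ?muln_gt0 ?addn_gt0 ?orbT//.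
have := leq_mul (leqnn ((k + 6) * (k + 4))) h1.
have := leq_mul (leqnn ((k + 3) * (k + 4))) h2.
clear; nia.
Qed.

(** After the weights [N] are lowered to [n], an induction of step 2 sums the
geometric sequence: passing from [N] to [N + 2] uses only the odd one of the two
new indices.  The constant [12] absorbs the accumulated errors. *)
Lemma sum_lower N :
  (forall n, odd n -> 2 ^ n <= n * a n + 2 ^ n./2.+1) ->
  2 ^ N.+1 <= 3 * (N * \sum_(n < N.+1) a n) + 12 * 2 ^ N./2.
Proof.
move=> an; suff : 2 ^ N.+1 <= 3 * (\sum_(n < N.+1) n * a n) + 12 * 2 ^ N./2.
  move/leq_trans; apply; rewrite leq_add2r leq_pmul2l// big_distrr/=.
  by apply: leq_sum => n _; rewrite leq_mul2r -ltnS ltn_ord orbT.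
have [n] := ubnP N; elim: n N => // n IH [_|[_|N]].
- by rewrite big_ord_recr big_ord0.
- by rewrite !big_ord_recr big_ord0 /=; lia.
rewrite ltnS => /ltnW /IH; rewrite 2!(big_ord_recr _.+1)/=.
set S := \sum_(i < _) _ => {}IH.
set x := N.+1 * a N.+1; set y := N.+2 * a N.+2.
case: (boolP (odd N)) => oN.
  have := an N.+2; rewrite /= negbK => /(_ oN).
  move: IH; rewrite -/y !expnS; move: x y (2 ^ N) (2 ^ N./2) => *; lia.
have := an N.+1; rewrite /= => /(_ oN); rewrite uphalf_half (negbTE oN).
move: IH; rewrite -/x !expnS; move: x y (2 ^ N) (2 ^ N./2) => *; lia.
Qed.
End Growth.

(** * Upper and lower limits *)

Import numFieldNormedType.Exports.

Section LimSupInf.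
Variable R : realType.
Implicit Types u v : nat -> \bar R.
Local Open Scope classical_set_scope.
Local Open Scope ereal_scope.

Lemma limn_esup_le_near u v l : (\forall n \near \oo, u n <= v n) ->
  v @ \oo --> l -> limn_esup u <= l.
Proof.
move=> [k _ uv] /cvg_limn_einf_sup[_ <-].
rewrite !limn_esup_lim; apply: lee_lim; [exact: is_cvg_esups..|].
exists k => // n /= kn; apply: ge_ereal_sup => _ [m /= nm <-].
apply: (le_trans (uv m (leq_trans kn nm))).
by apply: ereal_sup_ubound; exists m.
Qed.

Lemma limn_einf_ge_near u v l : (\forall n \near \oo, v n <= u n) ->
  v @ \oo --> l -> l <= limn_einf u.
Proof.
move=> [k _ uv] vl; rewrite /limn_einf leeNr.
apply: (@limn_esup_le_near _ (\- v)); last exact: cvgeN.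
by exists k => // n /= kn; rewrite leeN2 uv.
Qed.

Lemma cvg_affine_harmonic (a b : R) :
  (fun n => (a + b * (n.+1%:R)^-1)%:E) @ \oo --> a%:E.
Proof.
apply: cvg_EFin; first by near=> n.
rewrite -[X in _ --> X]addr0 -(mulr0 b).
apply: cvgD; first exact: cvg_cst.
by apply: cvgMr; exact: cvg_harmonic.
Unshelve. all: end_near.
Qed.

End LimSupInf.

(** * Counting the closed orbits *)

Section OrbitGrowth.
Variable R : realType.
Local Notation f := (@dual_doubling R).
Local Notation g := (@circle_doubling R).

(* Counting elements with [fset_set] needs choice types. *)
Let X : choiceType := {classic dual R Z3frac}.
Let C : choiceType := {classic circle R}.

Lemma finite_least_period_circle n : (0 < n)%N -> finite_set (least_period g n).
Proof.
move=> n0; apply: (@sub_finite_set _ _ (fixed g n)); first exact: least_period_sub.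
by apply/finite_set_leP; exists (2 ^ n).-1; exact: fixed_circle_le.
Qed.

Lemma card_least_period_dual n : (0 < n)%N ->
  (least_period f n #<= least_period g n)%card.
Proof.
by move=> n0; have [h] := dual_circle_semiconj R n0; exact: card_least_period_semiconj.
Qed.

Lemma card_fixed_dual_le n : (0 < n)%N -> (fixed f n #<= `I_(2 ^ n).-1)%card.
Proof.
move=> n0; have [h hinj hT] := dual_circle_semiconj R n0.
exact: card_le_trans (card_fixed_semiconj hinj hT) (fixed_circle_le R n0).
Qed.

Lemma finite_fixed_dual n : (0 < n)%N -> finite_set (fixed f n).
Proof.
by move=> n0; apply/finite_set_leP; exists (2 ^ n).-1; exact: card_fixed_dual_le.
Qed.

Lemma finite_least_period_dual n : (0 < n)%N -> finite_set (least_period f n).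
Proof.
move=> n0; apply: sub_finite_set (finite_fixed_dual n0); exact: least_period_sub.
Qed.

Lemma orbits_dual_le_circle n : (0 < n)%N ->
  (orbits_of_length f n <= orbits_of_length g n)%N.
Proof.
move=> n0; rewrite -(leq_pmul2l n0).
rewrite -(card_least_period (Y := C) n0 (finite_least_period_circle n0)).
rewrite -(card_least_period (Y := X) n0 (finite_least_period_dual n0)).
have /finite_setP[k gk] := finite_least_period_circle n0.
rewrite (card_fset_set (T := C) gk); apply: (geq_card_fset_set (T := X)).
by rewrite -(card_le_eqr gk); exact: card_least_period_dual.
Qed.

Lemma orbits_dual_le n : (0 < n)%N -> (n * orbits_of_length f n <= 2 ^ n)%N.
Proof.
move=> n0; rewrite -(card_least_period (Y := X) n0 (finite_least_period_dual n0)).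
apply: leq_trans (leq_pred _); apply: (geq_card_fset_set (T := X)).
apply: card_le_trans (card_fixed_dual_le n0).
by apply: subset_card_le; exact: least_period_sub.
Qed.

(** The [2 ^ n - 1] characters fixed by the [n]-th iterate, less those of period
[d <= n / 2], which number at most [2 ^ d - 1] for each [d].  For [n = 1] the
inequality is trivial. *)
Lemma orbits_dual_ge n : odd n -> (2 ^ n <= n * orbits_of_length f n + 2 ^ n./2.+1)%N.
Proof.
case: n => [|[|n]] // on; first by rewrite leq_addl.
set N := n.+2; have N0 : (0 < N)%N by [].
rewrite -(card_least_period (Y := X) N0 (finite_least_period_dual N0)).
have fixN : ((2 ^ N).-1 <= #|` fset_set (fixed (f : X -> X) N)|)%N.
  by apply: leq_card_fset_set; [exact: finite_fixed_dual|exact: card_fixed_dual].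
have := card_fixed_le (T := f : X -> X) N0 finite_fixed_dual.
set s := (\sum_(d < _) _)%N => le1.
have : (s <= (2 ^ N./2.+1) - 2)%N.
  apply: (@leq_trans (\sum_(d < N./2) 2 ^ d.+1)%N).
    apply: leq_sum => d _; apply: leq_trans (leq_pred _).
    by apply: (geq_card_fset_set (T := X)); exact: card_fixed_dual_le.
  elim: (N./2) => [|h IH]; first by rewrite big_ord0.
  rewrite big_ord_recr/=; move: IH; set S := (\sum_(i < _) _)%N.
  have : (0 < 2 ^ h)%N by rewrite expn_gt0.
  by rewrite !expnS; lia.
have : (2 <= 2 ^ N./2.+1)%N by rewrite -{1}(expn1 2) leq_exp2l.
have : (0 < 2 ^ N)%N by rewrite expn_gt0.
move: fixN le1; clearbody s; lia.
Qed.

Lemma orbit_count_dual N : orbit_count f N = (\sum_(n < N.+1) orbits_of_length f n)%N.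
Proof. by apply: (orbit_countE (Y := X)); exact: finite_least_period_dual. Qed.

Lemma orbit_count_circle N : orbit_count g N = (\sum_(n < N.+1) orbits_of_length g n)%N.
Proof. by apply: (orbit_countE (Y := C)); exact: finite_least_period_circle. Qed.

(** [N / (N - 2) <= 1 + 6 / (N + 1)] from [N = 5] on; this turns [sum_upper] into a
bound whose limit is immediate. *)
Lemma orbit_count_dual_le N : (5 <= N)%N ->
  (N * orbit_count f N)%:R / 2 ^+ N.+1 <= 1 + 6 * N.+1%:R^-1 :> R.
Proof.
move=> N5; rewrite orbit_count_dual.
have := sum_upper (orbits_of_length0 f) orbits_dual_le N5.
set P := (\sum_(n < _) _)%N => le.
have p2 : 0 < 2 ^+ N.+1 :> R by rewrite exprn_gt0.
rewrite ler_pdivrMr// -natrX -[X in _ <= (_ + _ * X) * _]mul1r.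
have -> : 1 + 6 * (1 / N.+1%:R) = (N + 7)%:R / N.+1%:R :> R.
  have -> : (N + 7 = N.+1 + 6)%N by lia.
  by rewrite (natrD _ N.+1 6) [RHS]mulrDl divff ?pnatr_eq0// mul1r.
rewrite mulrAC ler_pdivlMr ?ltr0n// -!natrM ler_nat.
have [k Nk] : exists k, N = (k + 5)%N by exists (N - 5)%N; lia.
have h1 : ((k + 3) * P <= 2 ^ N.+1)%N.
  by apply: leq_trans le; rewrite leq_mul2r; apply/orP; right; lia.
move: (2 ^ N.+1)%N h1 => Q h1; rewrite {}Nk.
rewrite -(@leq_pmul2l (k + 3)) ?addn_gt0 ?orbT//.
have h2 := leq_mul (leqnn ((k + 5) * (k + 6))%N) h1.
have -> : ((k + 3) * ((k + 5) * P * (k + 5).+1) =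
           (k + 5) * (k + 6) * ((k + 3) * P))%N by ring.
apply: leq_trans h2 _; rewrite mulnA leq_mul2r; apply/orP; right; nia.
Qed.

(** The error term of [sum_lower], relative to [3 * 2 ^ (N + 1)], is at most
[4 / (N + 1)], because [(N + 1) 2 ^ (N / 2) <= 2 ^ (N + 1)]. *)
Lemma orbit_count_dual_ge N :
  3^-1 + - 4 * N.+1%:R^-1 <= (N * orbit_count f N)%:R / 2 ^+ N.+1 :> R.
Proof.
rewrite orbit_count_dual.
have := sum_lower N orbits_dual_ge; set P := (\sum_(n < _) _)%N => le.
have p2 : 0 < 2 ^+ N.+1 :> R by rewrite exprn_gt0.
have small : (N.+1 * 2 ^ N./2 <= 2 ^ N.+1)%N.
  have h : (N./2 < 2 ^ N./2)%N by exact: ltn_expl.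
  rewrite -[in leqRHS](odd_double_half N) expnS expnD -addnn expnD.
  have : (1 <= 2 ^ odd N)%N by rewrite expn_gt0.
  have := odd_double_half N; move: (2 ^ odd N)%N h => c; move: (2 ^ N./2)%N => y.
  move=> h En c1.
  have : (N.+1 <= 2 * y)%N by move: En; case: (odd N); lia.
  move=> /leq_mul/(_ (leqnn y))/leq_trans; apply.
  by rewrite -mulnA leq_mul2l/= leq_pmull.
rewrite ler_pdivlMr// -natrX.
move: small le; rewrite -(ler_nat R) natrM => small.
rewrite -(ler_nat R) natrD !natrM => le.
have N1 : 0 < N.+1%:R :> R by rewrite ltr0n.
have : (2 ^ N./2)%:R <= N.+1%:R^-1 * (2 ^ N.+1)%:R :> R.
  by rewrite -ler_pdivrMl ?invr_gt0// invrK.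
move=> {}small; rewrite [leLHS]mulrDl -[- 4 * _ * _]mulrA.
move: le small; set x := _ * P%:R; set y := _^-1 * (2 ^ N.+1)%:R.
lra.
Qed.

End OrbitGrowth.

Theorem theorem3 (R : realType) :
  let pi_f := orbit_count (@dual_doubling R) in
  let pi_g := orbit_count (@circle_doubling R) in
  (forall N : nat, (1 <= N)%N -> (pi_f N <= pi_g N)%N) /\
  (limn_esup (fun N : nat => ((N * pi_f N)%:R / 2 ^+ N.+1 : R)%:E) <= 1)%E /\
  ((3^-1 : R)%:E <= limn_einf (fun N : nat => ((N * pi_f N)%:R / 2 ^+ N.+1 : R)%:E))%E.
Proof.
move=> pi_f pi_g; split; [|split].
- move=> N _; rewrite /pi_f /pi_g orbit_count_dual orbit_count_circle.
  apply: leq_sum => -[[|n] nN] _; last exact: orbits_dual_le_circle.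
  by rewrite /= !orbits_of_length0.
- apply: limn_esup_le_near (@cvg_affine_harmonic R 1 6).
  by exists 5%N => // N /= N5; rewrite lee_fin orbit_count_dual_le.
- apply: limn_einf_ge_near (@cvg_affine_harmonic R 3^-1 (- 4)).
  by exists 0%N => // N _ /=; rewrite lee_fin orbit_count_dual_ge.
Qed.
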